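(* Let $k\ge 3$, $\omega=\cos(2\pi/k)+\mathbf{i}\sin(2\pi/k)$, and let $M_G$ be a connected mixed graph with underlying graph $G$ of maximum degree $\Delta(G)$. Then every eigenvalue $\lambda$ of $H(M_G)$ satisfies $|\lambda|\le\Delta(G)$. Moreover, $\rho(M_G)=\Delta(G)$ if and only if $G$ is $\Delta(G)$-regular and one can partition $V(M_G)$ into $k$ (possibly empty) parts $V_1,\dots,V_k$ such that one of the following holds: (i) every undirected edge $uv$ satisfies $u,v\in V_j$ for some $j$, and every arc from $u$ to $v$ satisfies $u\in V_r$, $v\in V_s$ with $r-s\equiv1\pmod k$; (ii) $k$ is even, each $V_j$ is an independent set in $M_G$, every undirected edge $uv$ satisfies $u\in V_j$, $v\in V_s$ with $s-j\equiv \frac k2\pmod k$, and every arc from $u$ to $v$ satisfies $u\in V_j$, $v\in V_r$ with $r-j\equiv \frac k2-1\pmod k$; (iii) $k$ is odd, and $V(M_G)$ can be partitioned into $2k$ (possibly empty) parts $V_1',\dots,V_k',V_1'',\dots,V_k''$ such that every undirected edge $uv$ satisfies $u\in V_j'$ and $v\in V_j''$ for some $j$, and every arc from $u$ to $v$ satisfies $u\in V_r'$, $v\in V_s''$ (or $u\in V_r''$, $v\in V_s'$) for some $r,s$ with $r-s\equiv 1\pmod k$.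
   Context: A mixed graph $M_G$ is obtained from a simple graph $G$ (its underlying graph) by leaving some edges undirected and replacing each other edge by an arc; it is connected if $G$ is, and the degree of a vertex is its degree in $G$. The Hermitian adjacency matrix $H(M_G)=(h_{uv})$ has $h_{uv}=\omega$ if there is an arc from $u$ to $v$, $h_{uv}=\overline{\omega}$ if there is an arc from $v$ to $u$, $h_{uv}=1$ if $uv$ is an undirected edge, and $0$ otherwise. The spectral radius is $\rho(M_G)=\max|\lambda|$ over the eigenvalues $\lambda$ of $H(M_G)$. *)

(* Defs.v *)
From mathcomp Require Import all_boot all_order all_algebra.
From mathcomp Require Import complex reals trigo.

Set Implicit Arguments.
Unset Strict Implicit.
Unset Printing Implicit Defensive.

Import Order.TTheory GRing.Theory Num.Theory.
Local Open Scope ring_scope.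

Record simple_graph (T : finType) := SimpleGraph {
  adj : rel T;
  adj_sym : symmetric adj;
  adj_irr : irreflexive adj }.

Definition connected_graph (T : finType) (G : simple_graph T) : Prop :=
  (0 < #|T|)%N /\ forall u v : T, connect (adj G) u v.

Definition degree (T : finType) (G : simple_graph T) (u : T) : nat :=
  #|[set v | adj G u v]|.

Definition max_degree (T : finType) (G : simple_graph T) : nat :=
  \max_(u : T) degree G u.

Definition regular_graph (T : finType) (G : simple_graph T) (d : nat) : Prop :=
  forall u : T, degree G u = d.

Definition independent_set (T : finType) (G : simple_graph T) (A : {set T}) : Prop :=
  {in A &, forall u v, ~~ adj G u v}.

(* A mixed graph with underlying graph G is determined by its arcs: each edge
   of G carries at most one arc, and the edges carrying none are undirected. *)
Record mixed_graph (T : finType) (G : simple_graph T) := MixedGraph {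
  has_arc : rel T;
  has_arc_adj : forall u v, has_arc u v -> adj G u v;
  has_arc_asym : forall u v, has_arc u v -> ~~ has_arc v u }.

Definition undirected (T : finType) (G : simple_graph T) (M : mixed_graph G) :
    rel T :=
  fun u v => [&& adj G u v, ~~ has_arc M u v & ~~ has_arc M v u].

Definition eigenvalues (R : realType) (n : nat) (A : 'M[R[i]]_n) : seq R[i] :=
  sval (closed_field_poly_normal (char_poly A)).

Lemma mem_eigenvalues (R : realType) (n : nat) (A : 'M[R[i]]_n) (a : R[i]) :
  (a \in eigenvalues A) = eigenvalue A a.
Proof.
rewrite eigenvalue_root_char /eigenvalues.
case: closed_field_poly_normal => s /= ps.
by rewrite [in RHS]ps (monicP (char_poly_monic A)) scale1r root_prod_XsubC.
Qed.

(* The norm on R[i] takes its (real) values in R[i], hence the real part. *)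
Definition spectral_radius (R : realType) (n : nat) (A : 'M[R[i]]_n) : R :=
  \big[Num.max/0]_(a <- eigenvalues A) complex.Re `|a|.

Definition omega (R : realType) (k : nat) : R[i] :=
  Complex (cos (2 * pi / k%:R)) (sin (2 * pi / k%:R)).

Definition hermitian_entry (R : realType) (k : nat) (T : finType)
    (G : simple_graph T) (M : mixed_graph G) (u v : T) : R[i] :=
  if has_arc M u v then omega R k
  else if has_arc M v u then (omega R k)^*
  else if undirected M u v then 1
  else 0.

Definition hermitian_adj (R : realType) (k : nat) (T : finType)
    (G : simple_graph T) (M : mixed_graph G) : 'M[R[i]]_#|T| :=
  \matrix_(i, j) hermitian_entry R k M (enum_val i) (enum_val j).

(* Unlike finset's partition, this allows empty parts. *)
Definition partition_into (T I : finType) (V : I -> {set T}) : Prop :=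
  \bigcup_(i : I) V i = [set: T] /\
  forall i j : I, i != j -> [disjoint V i & V j].

(* In the three conditions below the indices 1, ..., k are replaced by
   0, ..., k - 1; they only matter modulo k. *)
Definition cond_i (k : nat) (T : finType) (G : simple_graph T)
    (M : mixed_graph G) (V : 'I_k -> {set T}) : Prop :=
  (forall u v, undirected M u v -> exists j : 'I_k, u \in V j /\ v \in V j) /\
  (forall u v, has_arc M u v -> exists r s : 'I_k,
     [/\ u \in V r, v \in V s & (r%:Z - s%:Z = 1 %[mod k%:Z])%Z]).

Definition cond_ii (k : nat) (T : finType) (G : simple_graph T)
    (M : mixed_graph G) (V : 'I_k -> {set T}) : Prop :=
  [/\ ~~ odd k,
      forall j : 'I_k, independent_set G (V j),
      forall u v, undirected M u v -> exists j s : 'I_k,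
        [/\ u \in V j, v \in V s & (s%:Z - j%:Z = k./2%:Z %[mod k%:Z])%Z]
    & forall u v, has_arc M u v -> exists j r : 'I_k,
        [/\ u \in V j, v \in V r & (r%:Z - j%:Z = k./2%:Z - 1 %[mod k%:Z])%Z]].

(* V' and V'' are the two halves of the partition into 2k parts. As uv is an
   unordered pair for an undirected edge, either end may lie in V' j. *)
Definition cond_iii (k : nat) (T : finType) (G : simple_graph T)
    (M : mixed_graph G) : Prop :=
  odd k /\
  exists V' V'' : 'I_k -> {set T},
    [/\ partition_into
          (fun x : 'I_k + 'I_k => match x with inl j => V' j | inr j => V'' j end),
        forall u v, undirected M u v -> exists j : 'I_k,
          (u \in V' j /\ v \in V'' j) \/ (v \in V' j /\ u \in V'' j)
      & forall u v, has_arc M u v -> exists r s : 'I_k,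
          ((u \in V' r /\ v \in V'' s) \/ (u \in V'' r /\ v \in V' s)) /\
          (r%:Z - s%:Z = 1 %[mod k%:Z])%Z].

(* Main.v *)
Require Import Defs.
From mathcomp Require Import all_boot all_order all_algebra.
From mathcomp Require Import spectral complex reals trigo.
Set Implicit Arguments.
Unset Strict Implicit.
Unset Printing Implicit Defensive.
Import Order.TTheory GRing.Theory Num.Theory.
Local Open Scope ring_scope.

(** Let x be an eigenvector of H for a with |a| = Delta. At a vertex u where |x|
    is maximal, a x_u is the sum of h_uv x_v over the neighbours v of u, and
    equality in the triangle inequality forces deg u = Delta, |x_v| = |x_u| and
    h_uv x_v = eps x_u, where a = Delta eps. By connectedness this holds at
    every vertex, and reading an edge in both directions gives eps = 1 or
    eps = -1: in the language of gain graphs, H is balanced or antibalanced.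
    After scaling x to 1 at one vertex, all values x_u are k-th roots of unity
    if eps ^ k = 1, and the part V_j is the set where x = omega ^ j. In the
    remaining case, eps = -1 with k odd, only x_u ^ (2 k) = 1 holds, and V'_j
    and V''_j are the sets where x = omega ^ j and x = - omega ^ j. Conversely,
    the labels of such a partition define an eigenvector of a regular graph for
    Delta or -Delta. *)

Section ConnectedGraph.
Variables (T : finType) (G : simple_graph T).

Lemma connected_ind (P : pred T) (u0 : T) :
    connected_graph G -> P u0 -> (forall u v, adj G u v -> P u -> P v) ->
  forall u, P u.
Proof.
move=> [_ conn] Pu0 Padj u; have symG := sym_connect_sym (@adj_sym _ G).
have closedP : closed (adj G) P := intro_closed symG Padj.
by rewrite -[P u]/(u \in P) -(closed_connect closedP (conn u0 u)).
Qed.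

Lemma degree_le_max (u : T) : (degree G u <= max_degree G)%N.
Proof. exact: (leq_bigmax u). Qed.

Lemma sum_adj (R : pzSemiRingType) (u : T) :
  \sum_v (adj G u v)%:R = (degree G u)%:R :> R.
Proof.
rewrite /degree -sum1dep_card [in RHS]big_mkcond natr_sum.
by apply: eq_bigr => v _; case: ifP.
Qed.

End ConnectedGraph.

Section Partition.
Variables (T I : finType).
Implicit Type V : I -> {set T}.

Lemma partition_intoP V :
  partition_into V <-> exists l : T -> I, forall u i, (u \in V i) = (l u == i).
Proof.
split=> [[coverV disjV] | [l lV]].
  have /fin_all_exists[l lV] u : exists i, u \in V i.
    by have := in_setT u; rewrite -coverV => /bigcupP[i _]; exists i.
  exists l => u i; apply/idP/eqP=> [uVi | <- //].
  by apply: contraTeq uVi => /disjV/disjointFr->.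
split=> [|i j].
  by apply/setP=> u; rewrite inE; apply/bigcupP; exists (l u); rewrite ?lV.
rewrite -setI_eq0; apply: contra_neqT => /set0Pn[u /setIP[]].
by rewrite !lV => /eqP<- /eqP.
Qed.

Lemma partition_into_fibers (l : T -> I) :
  partition_into (fun i => [set u | l u == i]).
Proof. by apply/partition_intoP; exists l => u i; rewrite inE. Qed.

End Partition.

Lemma eigenvalue_trmx (F : fieldType) (n : nat) (A : 'M[F]_n) :
  eigenvalue A^T =1 eigenvalue A.
Proof.
move=> a; rewrite !eigenvalue_root_char /char_poly -det_tr.
by rewrite /char_poly_mx linearB /= tr_scalar_mx map_trmx trmxK.
Qed.

Section SpectralRadius.
Variables (R : realType) (n : nat) (A : 'M[R[i]]_n).

Lemma normc_real (z : R[i]) : `|z| = (complex.Re `|z|)%:C%C.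
Proof. by rewrite normc_def. Qed.

Lemma eigenvalue_le_spectral_radius (a : R[i]) :
  eigenvalue A a -> `|a| <= (spectral_radius A)%:C%C.
Proof.
rewrite -mem_eigenvalues normc_real lecR => aA.
exact: (@bigmax_sup_seq _ _ _ _ _ a).
Qed.

Lemma spectral_radius_attained :
  (0 < n)%N -> exists2 a, eigenvalue A a & `|a| = (spectral_radius A)%:C%C.
Proof.
move=> n_gt0; have [b] := eigenvalue_closed A n_gt0.
rewrite -mem_eigenvalues => /seq_tnthP[i _].
pose a j := tnth (in_tuple (eigenvalues A)) j.
have [j _|j _ rhoE] :=
  @eq_bigmax _ _ _ 0 i xpredT (fun j => complex.Re `|a j|) isT.
  by rewrite -lecR -normc_real; apply: normr_ge0.
exists (a j); first by rewrite -mem_eigenvalues mem_tnth.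
by rewrite normc_real /spectral_radius big_tnth rhoE.
Qed.

Lemma spectral_radiusP (r : R) :
    (0 < n)%N ->
  spectral_radius A = r <->
  (forall a, eigenvalue A a -> `|a| <= r%:C%C) /\
  exists2 a, eigenvalue A a & `|a| = r%:C%C.
Proof.
move=> n_gt0; have [b bA bE] := spectral_radius_attained n_gt0.
split=> [<- | [le_r [a aA aE]]].
  by split; [exact: eigenvalue_le_spectral_radius | exists b].
apply/le_anti; rewrite -!lecR -bE le_r //= bE -aE.
exact: eigenvalue_le_spectral_radius.
Qed.

End SpectralRadius.

Section GainGraph.
Variables (F : fieldType) (T : finType) (G : simple_graph T) (h : T -> T -> F).

Definition gain_matrix : 'M[F]_#|T| :=
  \matrix_(i, j) h (enum_val i) (enum_val j).

Lemma eigenvalue_gain_matrixP (a : F) :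
  eigenvalue gain_matrix a <->
  exists2 x : T -> F, exists u, x u != 0 &
    forall u, \sum_v h u v * x v = a * x u.
Proof.
have sumE (x : T -> F) u :
    \sum_v h u v * x v = \sum_(i < #|T|) h u (enum_val i) * x (enum_val i).
  by rewrite -(big_enum_val (A := T) (fun v => h u v * x v)).
rewrite -eigenvalue_trmx; split=> [/eigenvalueP[y yH y0] | [x [u xu0] xH]].
  exists (fun u => y 0 (enum_rank u)).
    have /rV0Pn[j yj] := y0.
    by exists (enum_val j); rewrite enum_valK.
  move=> u; have /rowP/(_ (enum_rank u)) := yH; rewrite !mxE sumE => <-.
  by apply: eq_bigr => i _; rewrite !mxE enum_valK enum_rankK mulrC.
apply/eigenvalueP; exists (\row_j x (enum_val j)).
  apply/rowP=> j; rewrite !mxE -xH sumE.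
  by apply: eq_bigr => i _; rewrite !mxE mulrC.
by apply/rV0Pn; exists (enum_rank u); rewrite mxE enum_rankK.
Qed.

Definition gain_potential (eps : F) (x : T -> F) : Prop :=
  (forall u, x u != 0) /\
  forall u v, adj G u v -> h u v * x v = eps * x u.

Definition gain_balanced (eps : F) : Prop :=
  exists x, gain_potential eps x.

End GainGraph.

Section UnitGainGraph.
Variables (C : numClosedFieldType) (T : finType) (G : simple_graph T).
Variable h : T -> T -> C.
Hypothesis conn : connected_graph G.
Hypothesis norm_gain : forall u v, `|h u v| = (adj G u v)%:R.
Hypothesis conj_gain : forall u v, h v u = (h u v)^*.
Local Notation Delta := (max_degree G).

Lemma normr_le_degree_at_max (a : C) (x : T -> C) (u : T) :
    x u != 0 -> (forall v, `|x v| <= `|x u|) ->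
    \sum_v h u v * x v = a * x u ->
  `|a| <= (degree G u)%:R.
Proof.
rewrite -normr_gt0 => xu_gt0 xmax xH.
rewrite -(ler_pM2r xu_gt0) -normrM -xH -sum_adj mulr_suml.
apply: le_trans (ler_norm_sum _ _ _) _; apply: ler_sum => v _.
by rewrite normrM norm_gain ler_wpM2l.
Qed.

Lemma gain_eigenvector_at_max (n : nat) (eps : C) (x : T -> C) (u : T) :
    x u != 0 -> (forall v, `|x v| <= `|x u|) -> `|eps| = 1 ->
    (degree G u <= n)%N -> \sum_v h u v * x v = n%:R * eps * x u ->
  degree G u = n /\ forall v, adj G u v -> h u v * x v = eps * x u.
Proof.
move=> xu0 xmax eps1 deg_le xH.
have eps0 : eps != 0 by rewrite -normr_eq0 eps1 oner_eq0.
have degE : degree G u = n.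
  apply/eqP; rewrite eqn_leq deg_le -(ler_nat C) /=.
  have := normr_le_degree_at_max xu0 xmax xH.
  by rewrite normrM normr_nat eps1 mulr1.
split=> // v uv; have exu0 : eps * x u != 0 by rewrite mulf_neq0.
have ratio_le w : true -> `|h u w * x w / (eps * x u)| <= (adj G u w)%:R.
  move=> _; rewrite !normrM normfV normrM eps1 mul1r norm_gain -mulrA.
  by rewrite ler_piMr // ler_pdivrMr ?normr_gt0 // mul1r.
have sum_ratio : \sum_w h u w * x w / (eps * x u) = \sum_w (adj G u w)%:R.
  by rewrite -mulr_suml xH sum_adj degE -(mulrA n%:R) mulfK.
have := normC_sum_upper ratio_le sum_ratio (erefl : xpredT v).
by rewrite uv => /(canRL (divfK exu0)); rewrite mul1r.
Qed.

Lemma exists_max_norm (x : T -> C) : exists u, forall v, `|x v| <= `|x u|.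
Proof.
have [/card_gt0P[u0 _] _] := conn.
have [|u _ umax] := @real_arg_maxP C T u0 predT (fun u => `|x u|) isT.
  by move=> u _; apply: normr_real.
by exists u => v; apply: umax.
Qed.

Lemma eigenvalue_le_max_degree (a : C) :
  eigenvalue (gain_matrix h) a -> `|a| <= Delta%:R.
Proof.
case/eigenvalue_gain_matrixP=> x [u0 xu0] xH.
have [u umax] := exists_max_norm x.
have xu : x u != 0 by rewrite -normr_gt0 (lt_le_trans _ (umax u0)) ?normr_gt0.
apply: le_trans (normr_le_degree_at_max xu umax (xH u)) _.
by rewrite ler_nat degree_le_max.
Qed.

Lemma eigenvector_gain_potential (eps : C) (x : T -> C) :
    (exists u, x u != 0) -> `|eps| = 1 ->
    (forall u, \sum_v h u v * x v = Delta%:R * eps * x u) ->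
  regular_graph G Delta /\ gain_potential G h eps x.
Proof.
move=> [u0 xu0] eps1 xH; have [m mmax] := exists_max_norm x.
have xm_gt0 : 0 < `|x m| by rewrite (lt_le_trans _ (mmax u0)) ?normr_gt0.
have max_local u : `|x u| = `|x m| ->
    degree G u = Delta /\ forall v, adj G u v -> h u v * x v = eps * x u.
  move=> xum; apply: gain_eigenvector_at_max (degree_le_max G u) (xH u) => //.
    by rewrite -normr_gt0 xum.
  by move=> v; rewrite xum.
have norm_const u : `|x u| = `|x m|.
  apply/eqP; move: u.
  apply: (connected_ind conn (eqxx `|x m|)) => u v uv /eqP xum.
  have [_ /(_ v uv)/(congr1 Num.norm)] := max_local u xum.
  by rewrite !normrM norm_gain uv eps1 !mul1r xum => ->.
split=> [u|]; first by have [] := max_local u (norm_const u).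
split=> [u|u]; first by rewrite -normr_gt0 norm_const.
by have [] := max_local u (norm_const u).
Qed.

Lemma gain_potential_eps_pm1 (eps : C) (x : T -> C) (u v : T) :
  gain_potential G h eps x -> adj G u v -> eps = 1 \/ eps = -1.
Proof.
move=> [x_neq0 pot] uv; have vu : adj G v u by rewrite adj_sym.
suff /eqP : eps ^+ 2 = 1 by rewrite sqrf_eq1 => /orP[] /eqP; [left | right].
apply: (mulIf (x_neq0 u)).
rewrite expr2 -mulrA -(pot u v uv) mulrCA -(pot v u vu).
by rewrite mulrA (conj_gain u v) -normCK norm_gain uv expr1n.
Qed.

Lemma gain_potential_balanced (eps : C) (x : T -> C) :
    gain_potential G h eps x ->
  gain_balanced G h 1 \/ gain_balanced G h (-1).
Proof.
move=> pot.
have [[u v] /= uv | no_edge] := pickP (fun e : T * T => adj G e.1 e.2).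
  by case: (gain_potential_eps_pm1 pot uv) => epsE; [left | right];
    exists x; rewrite -epsE.
by left; exists x; split=> [|u v]; [exact: pot.1 | rewrite (no_edge (u, v))].
Qed.

Lemma gain_potential_eigenvalue (d : nat) (eps : C) (x : T -> C) :
    regular_graph G d -> gain_potential G h eps x ->
  eigenvalue (gain_matrix h) (d%:R * eps).
Proof.
move=> reg [x_neq0 pot]; have [/card_gt0P[u0 _] _] := conn.
apply/eigenvalue_gain_matrixP; exists x; first by exists u0.
move=> u; rewrite -mulrA -(reg u) -sum_adj mulr_suml.
apply: eq_bigr => v _; have [/pot-> | nuv] := boolP (adj G u v).
  by rewrite mul1r.
have /normr0_eq0-> : `|h u v| = 0 by rewrite norm_gain (negPf nuv).
by rewrite !mul0r.
Qed.

Lemma max_degree_eigenvalueP :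
  (exists2 a, eigenvalue (gain_matrix h) a & `|a| = Delta%:R) <->
  regular_graph G Delta /\
  (gain_balanced G h 1 \/ gain_balanced G h (-1)).
Proof.
split=> [[a /eigenvalue_gain_matrixP[x x_neq0 xH] aD] | [reg pot]].
  have [eps eps1 aE] : exists2 eps, `|eps| = 1 & a = Delta%:R * eps.
    have [D0 | D_neq0] := eqVneq (Delta%:R : C) 0.
      by exists 1; rewrite ?normr1 // D0 mul0r; apply/normr0_eq0; rewrite aD.
    exists (a / Delta%:R); last by rewrite mulrC divfK.
    by rewrite normf_div aD normr_nat divff.
  rewrite aE in xH; have [reg pot] := eigenvector_gain_potential x_neq0 eps1 xH.
  by split=> //; apply: gain_potential_balanced pot.
by case: pot => -[x /(gain_potential_eigenvalue reg)];
  rewrite ?mulr1 ?mulrN1 => aH; [exists Delta%:R | exists (- Delta%:R)];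
  rewrite ?normrN ?normr_nat.
Qed.

End UnitGainGraph.

Section PrimitiveRoot.
Variables (F : fieldType) (k : nat) (w : F).
Hypothesis prim_w : k.-primitive_root w.

Lemma prim_root_neq0 : w != 0.
Proof. by rewrite (prim_root_eq0 prim_w) -lt0n (prim_order_gt0 prim_w). Qed.

Lemma eq_prim_root_exprz (m n : int) :
  (w ^ m == w ^ n) = (m == n %[mod k%:Z])%Z.
Proof.
have w0 := prim_root_neq0.
rewrite eqz_mod_dvd -[m in LHS](subrK n) expfzDr //.
rewrite -{2}[w ^ n]mul1r (inj_eq (mulIf _)) ?expfz_neq0 //.
rewrite dvdzE (prim_order_dvd prim_w).
by case: (m - n) => d //; rewrite NegzE abszN -invr_expz invr_eq1.
Qed.

Lemma modz_sub_prim_rootP (m n : nat) (c : int) :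
  (m%:Z - n%:Z = c %[mod k%:Z])%Z <-> w ^+ m = w ^ c * w ^+ n.
Proof.
rewrite !exprnP -expfzDr ?prim_root_neq0 //; apply: (iff_trans (rwP eqP)).
by rewrite (rwP (_ =P w ^ (c + n))) eq_prim_root_exprz -(eqz_modDr n) subrK.
Qed.

Lemma prim_root_expr_inj : injective (fun j : 'I_k => w ^+ j).
Proof.
move=> i j /eqP; rewrite (eq_prim_root_expr prim_w) !modn_small //.
by move=> /eqP/val_inj.
Qed.

Lemma prim_root_expr_half : ~~ odd k -> w ^+ k./2 = -1.
Proof.
move=> k_even; have halfK : (k./2 * 2)%N = k by rewrite muln2 even_halfK.
have half_gt0 : (0 < k./2)%N.
  by have := prim_order_gt0 prim_w; rewrite -{1}halfK muln_gt0 andbT.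
have half_lt : (k./2 < k)%N by rewrite -{2}halfK ltn_Pmulr.
have /eqP : (w ^+ k./2) ^+ 2 = 1 by rewrite -exprM halfK prim_expr_order.
rewrite sqrf_eq1 -(prim_order_dvd prim_w) => /orP[/(dvdn_leq half_gt0)|/eqP//].
by rewrite leqNgt half_lt.
Qed.

End PrimitiveRoot.

Lemma signr_unity_inj (F : fieldType) (k : nat) (b c : bool) (z t : F) :
    (-1 : F) != 1 -> odd k -> z ^+ k = 1 -> t ^+ k = 1 ->
  (-1) ^+ b * z = (-1) ^+ c * t -> b = c /\ z = t.
Proof.
move=> N1 k_odd zk tk eq_zt; suff eq_bc : b = c.
  by split=> //; move: eq_zt; rewrite eq_bc => /(inv_inj (signrMK _)).
have sign_odd (s : bool) : ((-1) ^+ s) ^+ k = (-1) ^+ s :> F.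
  by rewrite -exprM mulnC exprM -signr_odd k_odd.
have /eqP := congr1 (fun y => y ^+ k) eq_zt.
rewrite !exprMn zk tk !mulr1 !sign_odd.
case: b c {eq_zt} => [] [] //; rewrite expr0 expr1.
  by rewrite (negPf N1).
by rewrite eq_sym (negPf N1).
Qed.

Section MixedPotential.
Variables (T : finType) (G : simple_graph T) (M : mixed_graph G).

Variant mixed_adj_spec (u v : T) : Prop :=
  | UndirectedEdge of undirected M u v & undirected M v u
  | ForwardArc of has_arc M u v
  | BackwardArc of has_arc M v u.

Lemma mixed_adjP (u v : T) : adj G u v -> mixed_adj_spec u v.
Proof.
move=> uv; have [/ForwardArc // | nuv] := boolP (has_arc M u v).
have [/BackwardArc // | nvu] := boolP (has_arc M v u).
by apply: UndirectedEdge; rewrite /undirected ?uv 1?(adj_sym G v) ?uv nuv nvu.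
Qed.

Variables (F : fieldType) (k : nat) (w : F).

Definition mixed_potential (eps : F) (x : T -> F) : Prop :=
  [/\ forall u, x u != 0,
      forall u v, undirected M u v -> x v = eps * x u
    & forall u v, has_arc M u v -> w * x v = eps * x u].

Definition mixed_balanced (eps : F) : Prop :=
  exists x, mixed_potential eps x.

Lemma eq_mixed_potential (eps : F) (x y : T -> F) :
  x =1 y -> mixed_potential eps x -> mixed_potential eps y.
Proof.
move=> xy [x0 potU potA].
by split=> [u|u v|u v]; rewrite -!xy; [apply: x0 | apply: potU | apply: potA].
Qed.

Lemma mixed_potentialZ (eps c : F) (x : T -> F) :
  c != 0 -> mixed_potential eps x -> mixed_potential eps (fun u => c * x u).
Proof.
move=> c0 [x0 potU potA]; split=> [u|u v uv|u v uv]; first by rewrite mulf_neq0.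
  by rewrite (potU u v uv) mulrCA.
by rewrite mulrCA (potA u v uv) mulrCA.
Qed.

Lemma mixed_potential_unity (n : nat) (eps : F) (x : T -> F) :
    connected_graph G -> eps ^+ n = 1 -> w ^+ n = 1 -> mixed_potential eps x ->
  exists2 y, mixed_potential eps y & forall u, y u ^+ n = 1.
Proof.
move=> conn epsn wn pot.
have [/card_gt0P[u0 _] _] := conn; have [x0 _ _] := pot.
have [y pot_y yu0] : exists2 y, mixed_potential eps y & y u0 = 1.
  exists (fun u => (x u0)^-1 * x u); last by rewrite mulVf.
  by apply: mixed_potentialZ; rewrite ?invr_eq0.
exists y => // u; apply/eqP; move: u; have [_ potU potA] := pot_y.
apply: (connected_ind (u0 := u0) conn) => [|u v /mixed_adjP uv /eqP yu].
  by rewrite yu0 expr1n.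
case: uv => [uv _ | uv | vu].
- by rewrite (potU u v uv) exprMn epsn yu mulr1.
- have /(congr1 (fun z => z ^+ n)) := potA u v uv.
  by rewrite !exprMn wn epsn yu !mul1r => ->.
have /(congr1 (fun z => z ^+ n)) := potA v u vu.
by rewrite !exprMn wn epsn yu !mul1r => <-.
Qed.

Hypothesis prim_w : k.-primitive_root w.

Lemma mixed_potential_label (eps : F) (x : T -> F) :
    connected_graph G -> eps ^+ k = 1 -> mixed_potential eps x ->
  exists l : T -> 'I_k, mixed_potential eps (fun u => w ^+ l u).
Proof.
move=> conn epsk pot.
have wk := prim_expr_order prim_w.
have [y pot_y y1] := mixed_potential_unity conn epsk wk pot.
have /fin_all_exists[l yl] u : exists j : 'I_k, y u = w ^+ j.
  by have [j] := prim_rootP prim_w (y1 u); exists j.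
by exists l; apply: eq_mixed_potential yl pot_y.
Qed.

Lemma mixed_potential_signed_label (x : T -> F) :
    odd k -> connected_graph G -> mixed_potential (-1) x ->
  exists (b : T -> bool) (l : T -> 'I_k),
    mixed_potential (-1) (fun u => (-1) ^+ b u * w ^+ l u).
Proof.
move=> k_odd conn pot; have wk := prim_expr_order prim_w.
have sqr_k (z : F) : z ^+ (k * 2) = (z ^+ k) ^+ 2 by rewrite exprM.
have [||y pot_y y1] := mixed_potential_unity (n := k * 2) conn _ _ pot.
- by rewrite mulnC exprM sqrrN !expr1n.
- by rewrite sqr_k wk expr1n.
have /fin_all_exists[bl ybl] u :
    exists bl : bool * 'I_k, y u = (-1) ^+ bl.1 * w ^+ bl.2.
  have /eqP := y1 u; rewrite sqr_k sqrf_eq1 => /orP[] /eqP yk.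
    by have [j ->] := prim_rootP prim_w yk; exists (false, j); rewrite mul1r.
  have [j yj] : {j : 'I_k | - y u = w ^+ j}.
    apply: (prim_rootP prim_w).
    by rewrite exprNn yk -signr_odd k_odd mulrNN mulr1.
  by exists (true, j); rewrite mulN1r -yj opprK.
exists (fun u => (bl u).1), (fun u => (bl u).2).
exact: eq_mixed_potential pot_y.
Qed.

Lemma cond_iP :
    connected_graph G ->
  (exists V : 'I_k -> {set T}, partition_into V /\ cond_i M V) <->
  mixed_balanced 1.
Proof.
move=> conn; have w0 := prim_root_neq0 prim_w.
split=> [[V [/partition_intoP[l Vl] [undV arcV]]] | [x pot]].
  exists (fun u => w ^+ l u); split=> [u|u v|u v]; rewrite ?mul1r ?expf_neq0 //.
    by case/undV=> j []; rewrite !Vl => /eqP-> /eqP->.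
  case/arcV=> r [s []]; rewrite !Vl => /eqP-> /eqP->.
  by move/(modz_sub_prim_rootP prim_w) => ->.
have [l [_ potU potA]] := mixed_potential_label conn (expr1n _ _) pot.
exists (fun j => [set u | l u == j]); split; first exact: partition_into_fibers.
split=> u v.
  move/potU; rewrite mul1r => /(prim_root_expr_inj prim_w) luv.
  by exists (l u); rewrite !inE luv eqxx.
move/potA; rewrite mul1r => wl; exists (l u), (l v); rewrite !inE !eqxx.
by split=> //; apply/(modz_sub_prim_rootP prim_w); rewrite -wl.
Qed.

Hypothesis N1_neq1 : (-1 : F) != 1.

Lemma mixed_potentialN1_adj_neq (x : T -> F) (u v : T) :
    (2 < k)%N -> mixed_potential (-1) x -> adj G u v -> x u != x v.
Proof.
move=> k_gt2 [x0 potU potA] uv; have w_neqN1 : w != -1.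
  apply/eqP=> wN1; have := prim_order_dvd prim_w 2.
  by rewrite wN1 sqrrN expr1n eqxx => /dvdn_leq-/(_ isT); rewrite leqNgt k_gt2.
apply/eqP=> xuv; case: (mixed_adjP uv) => [/potU + _ | /potA | /potA].
- rewrite xuv -[LHS]mul1r => /(mulIf (x0 v))/eqP.
  by rewrite eq_sym (negPf N1_neq1).
- by rewrite xuv => /(mulIf (x0 v))/eqP; rewrite (negPf w_neqN1).
- by rewrite xuv => /(mulIf (x0 v))/eqP; rewrite (negPf w_neqN1).
Qed.

Lemma cond_iiP :
    (2 < k)%N -> ~~ odd k -> connected_graph G ->
  (exists V : 'I_k -> {set T}, partition_into V /\ cond_ii M V) <->
  mixed_balanced (-1).
Proof.
move=> k_gt2 k_even conn; have w0 := prim_root_neq0 prim_w.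
have half := prim_root_expr_half prim_w k_even.
have w_half1 : w ^ (k./2%:Z - 1) = - w^-1.
  by rewrite expfzDr // -exprnP half mulN1r.
split=> [[V [/partition_intoP[l Vl] [_ _ undV arcV]]] | [x pot]].
  exists (fun u => w ^+ l u); split=> [u|u v|u v]; rewrite ?expf_neq0 //.
    case/undV=> j [s []]; rewrite !Vl => /eqP-> /eqP->.
    by move/(modz_sub_prim_rootP prim_w) => ->; rewrite -exprnP half.
  case/arcV=> j [r []]; rewrite !Vl => /eqP-> /eqP->.
  move/(modz_sub_prim_rootP prim_w) => ->.
  by rewrite w_half1 mulrA mulrN divff.
have epsk : (-1) ^+ k = 1 :> F by rewrite -signr_odd (negPf k_even).
have [l pot_l] := mixed_potential_label conn epsk pot.
have [_ potU potA] := pot_l.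
exists (fun j => [set u | l u == j]); split; first exact: partition_into_fibers.
split=> // [j u v|u v|u v].
- rewrite !inE => /eqP<- /eqP lvu; apply/negP.
  by move/(mixed_potentialN1_adj_neq k_gt2 pot_l); rewrite lvu eqxx.
- move/potU => lvu; exists (l u), (l v); rewrite !inE !eqxx; split=> //.
  by apply/(modz_sub_prim_rootP prim_w); rewrite -exprnP half.
move/potA => lvu; exists (l u), (l v); rewrite !inE !eqxx; split=> //.
apply/(modz_sub_prim_rootP prim_w); rewrite w_half1 mulNr mulrC -mulNr.
by apply: (canRL (mulfK w0)); rewrite mulrC lvu mulN1r.
Qed.

Lemma cond_iiiP :
    odd k -> connected_graph G ->
  cond_iii k M <-> mixed_balanced (-1).
Proof.
move=> k_odd conn; have w0 := prim_root_neq0 prim_w.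
have unity (m : nat) : (w ^+ m) ^+ k = 1.
  by rewrite exprAC (prim_expr_order prim_w) expr1n.
split=> [[_ [V' [V'' [/partition_intoP[l Vl] undV arcV]]]] | [x pot]].
  pose x u := match l u with inl j => w ^+ j | inr j => - w ^+ j end.
  have xV' j u : u \in V' j -> x u = w ^+ j.
    by rewrite (Vl u (inl j)) /x => /eqP->.
  have xV'' j u : u \in V'' j -> x u = - w ^+ j.
    by rewrite (Vl u (inr j)) /x => /eqP->.
  exists x; split=> [u|u v|u v].
  - by rewrite /x; case: (l u) => j; rewrite ?oppr_eq0 expf_neq0.
  - by case/undV=> j [] [/xV'-> /xV''->]; rewrite mulN1r ?opprK.
  case/arcV=> r [s [uv /(modz_sub_prim_rootP prim_w) rs]].
  by case: uv => [[/xV'-> /xV''->] | [/xV''-> /xV'->]];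
    rewrite rs mulN1r ?mulrN ?opprK.
have [b [l [_ potU potA]]] := mixed_potential_signed_label k_odd conn pot.
split=> //; pose part c j := [set u | (b u == c) && (l u == j)].
exists (part false), (part true); split.
- apply/partition_intoP; exists (fun u => if b u then inr (l u) else inl (l u)).
  by move=> u [] j; rewrite !inE; case: (b u).
- move=> u v /potU; rewrite mulN1r -mulNr -signrN.
  case/(signr_unity_inj N1_neq1 k_odd (unity _) (unity _)) => bv.
  move/(prim_root_expr_inj prim_w) => lv; exists (l u).
  by rewrite !inE bv lv !eqxx; case: (b u); [right | left].
move=> u v /potA; rewrite mulN1r -mulNr -signrN mulrCA -exprS.
case/(signr_unity_inj N1_neq1 k_odd (unity _) (unity _)) => bv lv.
exists (l u), (l v); split; last first.
  by apply/(modz_sub_prim_rootP prim_w); rewrite -lv exprS.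
by rewrite !inE bv !eqxx; case: (b u); [right | left].
Qed.

Lemma partition_condP :
    (2 < k)%N -> connected_graph G ->
  (exists V : 'I_k -> {set T},
     partition_into V /\ [\/ cond_i M V, cond_ii M V | cond_iii k M]) <->
  mixed_balanced 1 \/ mixed_balanced (-1).
Proof.
move=> k_gt2 conn; have k_gt0 := prim_order_gt0 prim_w.
split=> [[V [pV [cV|cV|c3]]] | [/(cond_iP conn)[V [pV cV]] | pot]].
- by left; apply/(cond_iP conn); exists V.
- have [k_even _ _ _] := cV.
  by right; apply/(cond_iiP k_gt2 k_even conn); exists V.
- by right; have [k_odd _] := c3; apply/(cond_iiiP k_odd conn).
- by exists V; split=> //; apply: Or31.
have [k_odd | k_even] := boolP (odd k).
  exists (fun j => [set _ | Ordinal k_gt0 == j]); split.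
    exact: (partition_into_fibers (fun=> Ordinal k_gt0)).
  by apply: Or33; apply/(cond_iiiP k_odd conn).
have /(cond_iiP k_gt2 k_even conn)[V [pV cV]] := pot.
by exists V; split=> //; apply: Or32.
Qed.

End MixedPotential.

Section Omega.
Variables (R : realType) (k : nat).
Hypothesis k_gt0 : (0 < k)%N.
Local Notation w := (omega R k).

Lemma expr_cos_sin (t : R) (n : nat) :
  (Complex (cos t) (sin t)) ^+ n = Complex (cos (t *+ n)) (sin (t *+ n)).
Proof.
elim: n => [|n IHn]; first by rewrite expr0 mulr0n cos0 sin0.
rewrite exprS IHn mulrS cosD sinD; apply/eqP; rewrite eq_complex /= eqxx /=.
by rewrite addrC.
Qed.

Lemma omega_primitive : k.-primitive_root w.
Proof.
have k0 : (k%:R : R) != 0 by rewrite pnatr_eq0 -lt0n.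
rewrite /primitive_root_of_unity k_gt0; apply/forallP => i; apply/eqP.
rewrite unity_rootE /omega expr_cos_sin.
set t := (_ *+ _); have -> : t = (pi * (i.+1%:R / k%:R)) *+ 2.
  by rewrite /t -[LHS]mulr_natr -[RHS]mulr_natl !mulrA mulrAC.
(* Halving the angle: cos (2 s) = 1 would force sin s = 0, but 0 < s < pi. *)
rewrite cos_mulr2n sin_mulr2n.
have [->|ne_ik] := eqVneq i.+1 k.
  by rewrite divff // mulr1 cospi sinpi mulr0 mul0rn sqrrN expr1n
             mulr2n addrK; apply/eqP.
have lt_ik : (i.+1 < k)%N by rewrite ltn_neqAle ne_ik ltn_ord.
apply/negbTE/eqP => -[+ _].
have : 0 < sin (pi * (i.+1%:R / k%:R)) :> R.
  apply: sin_gt0_pi; rewrite mulr_gt0 ?pi_gt0 ?divr_gt0 ?ltr0n //=.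
  by rewrite gtr_pMr ?pi_gt0 // ltr_pdivrMr ?ltr0n // mul1r ltr_nat.
move=> /gt_eqF; rewrite -sqrf_eq0 sin2cos2 => sin_neq0 /(canRL (subrK _)).
rewrite -mulr2n => /(pmulrnI (ltn0Sn 1)) cos_eq1.
by rewrite cos_eq1 subrr eqxx in sin_neq0.
Qed.

Lemma norm_omega : `|w| = 1.
Proof. by rewrite normc_def /= cos2Dsin2 sqrtr1. Qed.

Variables (T : finType) (G : simple_graph T) (M : mixed_graph G).
Local Notation h := (hermitian_entry R k M).

Lemma norm_hermitian_entry (u v : T) : `|h u v| = (adj G u v)%:R.
Proof.
rewrite /hermitian_entry; case: ifPn => [/has_arc_adj-> | nuv].
  exact: norm_omega.
case: ifPn => [/has_arc_adj | nvu].
  by rewrite adj_sym => ->; rewrite norm_conjC norm_omega.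
by rewrite /undirected nuv nvu !andbT; case: ifP; rewrite ?normr1 ?normr0.
Qed.

Lemma conj_hermitian_entry (u v : T) : h v u = (h u v)^*.
Proof.
rewrite /hermitian_entry; have [uv | nuv] := boolP (has_arc M u v).
  by rewrite (negPf (has_arc_asym uv)).
have [vu | nvu] := boolP (has_arc M v u); first by rewrite conjCK.
by rewrite /undirected adj_sym nuv nvu; case: ifP; rewrite ?rmorph1 ?rmorph0.
Qed.

Lemma hermitian_gain_potentialP (eps : R[i]) (x : T -> R[i]) :
    eps ^+ 2 = 1 ->
  gain_potential G h eps x <-> mixed_potential M w eps x.
Proof.
move=> eps2; split=> [[x0 pot] | [x0 potU potA]].
  split=> // u v uv.
    have /and3P[uv_adj /negPf nuv /negPf nvu] := uv.
    by rewrite -(pot u v) // /hermitian_entry nuv nvu uv mul1r.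
  by rewrite -(pot u v) ?(has_arc_adj uv) // /hermitian_entry uv.
split=> // u v /(mixed_adjP M)[uv _ | uv | vu].
- have /and3P[_ /negPf nuv /negPf nvu] := uv.
  by rewrite /hermitian_entry nuv nvu uv mul1r (potU u v uv).
- by rewrite /hermitian_entry uv (potA u v uv).
rewrite /hermitian_entry vu (negPf (has_arc_asym vu)).
have -> : x v = eps * (w * x u).
  by rewrite (potA v u vu) mulrA -expr2 eps2 mul1r.
by rewrite mulrCA (mulrA _ w) [_ * w]mulrC -normCK norm_omega expr1n mul1r.
Qed.

Lemma hermitian_gain_balancedP (eps : R[i]) :
  eps ^+ 2 = 1 -> gain_balanced G h eps <-> mixed_balanced M w eps.
Proof.
move=> eps2.
by split=> -[x /hermitian_gain_potentialP pot]; exists x; apply: pot.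
Qed.

End Omega.

Theorem theorem4p1 (R : realType) (k : nat) (hk : (3 <= k)%N)
    (T : finType) (G : simple_graph T) (M : mixed_graph G)
    (hconn : connected_graph G) :
  (forall a : R[i], eigenvalue (hermitian_adj R k M) a ->
     `|a| <= (max_degree G)%:R) /\
  (spectral_radius (hermitian_adj R k M) = (max_degree G)%:R <->
   regular_graph G (max_degree G) /\
   exists V : 'I_k -> {set T},
     partition_into V /\
     [\/ cond_i M V, cond_ii M V | cond_iii k M]).
Proof.
have k_gt0 : (0 < k)%N by apply: ltnW (ltnW hk).
have prim_w := omega_primitive R k_gt0.
have N1_neq1 : (-1 : R[i]) != 1 by rewrite eqNr oner_eq0.
have normH := norm_hermitian_entry R k M.
have conjH := conj_hermitian_entry R k M.
have bound := eigenvalue_le_max_degree hconn normH.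
split; first exact: bound.
rewrite (partition_condP M prim_w N1_neq1 hk hconn).
rewrite -!hermitian_gain_balancedP ?sqrrN ?expr1n //.
rewrite -(max_degree_eigenvalueP hconn normH conjH).
rewrite (spectral_radiusP _ _ hconn.1) rmorph_nat.
by split=> [[] | attained].
Qed.
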